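(* Let $\mathbb{K}$ be an algebraically closed field of characteristic $0$. The set $\mathcal{HL}_4$ of the $4$-dimensional Hom-Lie algebras over $\mathbb{K}$ is an affine algebraic variety (a Zariski closed subset) strictly contained in the affine space $\mathcal{SA}lg_4$ of all $4$-dimensional skew-symmetric $\mathbb{K}$-algebras, which is isomorphic to $\mathbb{K}^{24}$.
   Context: A skew-symmetric algebra over $\mathbb{K}$ is a pair $(\mathcal{A},\mu)$ with $\mathcal{A}$ a $\mathbb{K}$-vector space and $\mu:\mathcal{A}\times\mathcal{A}\to\mathcal{A}$ a skew-symmetric bilinear map. Fix a basis $\{e_1,e_2,e_3,e_4\}$ of $\mathbb{K}^4$. $\mathcal{SA}lg_4$ denotes the set of skew-symmetric multiplications $\mu$ on $\mathbb{K}^4$, identified with the affine space $\mathbb{K}^{24}$ through the structure constants $C_{i,j}^k$, $1\le i<j\le 4$, $1\le k\le 4$, defined by $\mu(e_i,e_j)=\sum_k C_{i,j}^k e_k$. The algebra $(\mathcal{A},\mu)$ is called a Hom-Lie algebra if there is a nonzero linear endomorphism $f$ of $\mathcal{A}$ such that $\mu(\mu(x,y),f(z))+\mu(\mu(y,z),f(x))+\mu(\mu(z,x),f(y))=0$ for all $x,y,z\in\mathcal{A}$. $\mathcal{HL}_4\subset\mathcal{SA}lg_4$ is the subset of multiplications that are Hom-Lie. *)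

(* Defs.v *)
From HB Require Import structures.
From mathcomp Require Import all_boot all_order all_algebra.
From mathcomp Require boolp.
From mathcomp Require Export mpoly.

Set Implicit Arguments.
Unset Strict Implicit.
Unset Printing Implicit Defensive.

Import GRing.Theory.
Local Open Scope ring_scope.

(* Bilinear maps K^4 x K^4 -> K^4, in curried form. *)
Notation bilin4 K := 'Hom('rV[K]_4, 'Hom('rV[K]_4, 'rV[K]_4)).

Definition skew_symmetric (K : fieldType) (mu : bilin4 K) : Prop :=
  forall x y : 'rV[K]_4, mu x y = - mu y x.

(* Decided classically: a boolean predicate is needed for SAlg4 to inherit its
   vector space structure from the bilinear maps. *)
Definition skew_pred (K : fieldType) : {pred bilin4 K} :=
  fun mu => boolp.asbool (skew_symmetric mu).

Lemma skew_predP (K : fieldType) (mu : bilin4 K) :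
  reflect (skew_symmetric mu) (mu \in @skew_pred K).
Proof. exact: boolp.asboolP. Qed.

Lemma skew_pred_submod (K : fieldType) : submod_closed (@skew_pred K).
Proof.
split=> [|a mu nu /skew_predP smu /skew_predP snu]; apply/skew_predP => x y.
  by rewrite !zero_lfunE oppr0.
by rewrite !add_lfunE !scale_lfunE smu snu scalerN opprD.
Qed.

HB.instance Definition _ (K : fieldType) :=
  GRing.isSubmodClosed.Build K (bilin4 K) (@skew_pred K) (@skew_pred_submod K).

Record SAlg4 (K : fieldType) := SAlg4_of {
  salg_mul :> bilin4 K;
  salg_mul_skew : salg_mul \in @skew_pred K }.

HB.instance Definition _ (K : fieldType) := [isSub for @salg_mul K].
HB.instance Definition _ (K : fieldType) := [Choice of SAlg4 K by <:].
HB.instance Definition _ (K : fieldType) :=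
  [SubChoice_isSubLmodule of SAlg4 K by <:].

Definition index_pairs : 6.-tuple ('I_4 * 'I_4) :=
  [tuple (inord 0, inord 1); (inord 0, inord 2); (inord 0, inord 3);
         (inord 1, inord 2); (inord 1, inord 3); (inord 2, inord 3)].

(* The C_{i,j}^k of mu(e_i, e_j) = \sum_k C_{i,j}^k e_k, for i < j, listed in
   lexicographic order of (i, j, k); 'rV_(6 * 4) is convertible to 'rV_24. *)
Definition structure_constants (K : fieldType) (e : 4.-tuple 'rV[K]_4)
    (mu : SAlg4 K) : 'rV[K]_24 :=
  mxvec (\matrix_(p < 6, k < 4)
    coord e k (mu (tnth e (tnth index_pairs p).1)
                  (tnth e (tnth index_pairs p).2))).

Definition hom_lie (K : fieldType) (mu : SAlg4 K) : Prop :=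
  exists2 f : 'End('rV[K]_4), f != 0 &
    forall x y z : 'rV[K]_4,
      mu (mu x y) (f z) + mu (mu y z) (f x) + mu (mu z x) (f y) = 0.

(* Zero loci of finite families; by Hilbert's basis theorem, arbitrary families
   of polynomials define the same subsets. *)
Definition zariski_closed (K : fieldType) (n : nat) (A : 'rV[K]_n -> Prop) :
    Prop :=
  exists ps : seq {mpoly K[n]},
    forall v : 'rV[K]_n, A v <-> (forall p, p \in ps -> p.@[v 0] = 0).

(* Main.v *)
Require Import Defs.
From HB Require Import structures.
From mathcomp Require Import all_boot all_order all_algebra.
From mathcomp Require boolp.

Set Implicit Arguments.
Unset Strict Implicit.
Unset Printing Implicit Defensive.

Import GRing.Theory.
Local Open Scope ring_scope.

(** Why the theorem holds.

    For a fixed multiplication mu, the Hom-Jacobi expression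
    mu(mu(x,y),f(z)) + mu(mu(y,z),f(x)) + mu(mu(z,x),f(y)) is linear in f and
    in each of x, y, z.  Hence mu is Hom-Lie exactly when a homogeneous linear
    system in the 16 unknown coordinates of f, with one equation for every
    basis triple and every coordinate of the result, has a nonzero solution
    ([hom_lie_mxP]).  The coefficients of this system are quadratic polynomials
    in the structure constants ([polynomial_hom_jacobian]).  A system has a
    nonzero solution if and only if all its maximal minors vanish
    ([nonzero_kernelP]), and each minor is a polynomial in the structure
    constants, so the Hom-Lie multiplications form a Zariski closed set
    ([zariski_closed_hom_lie]).

    The identification with affine 24-space comes from an explicit inverse
    [salg_of]: a skew bilinear map depends on (x, y) only through the 2 x 2
    minors x_i y_j - x_j y_i with i < j, and linearly so.  The structure
    constants determine the products e_i e_j for i < j; the others follow from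
    skew-symmetry, the diagonal ones because 2 is invertible
    ([structure_constants_inj]).

    The inclusion is strict because of the algebra with e0 e1 = 0, e0 e2 = e0,
    e0 e3 = e3, e1 e2 = e3, e1 e3 = e2 and e2 e3 = e1: for it, the linear system
    contains 16 equations that can be ordered so that each involves, besides
    entries of f already known to vanish, a single new entry with coefficient
    1 or -1.  So f = 0 is the only solution ([witness_not_hom_lie]). *)

(** * Determinantal Zariski closed sets *)

Section PolynomialFunctions.
Variables (K : fieldType) (n : nat).
Implicit Types (g h : 'rV[K]_n -> K).

Definition polynomial_fun g : Prop :=
  exists p : {mpoly K[n]}, forall v, g v = p.@[v 0].

Lemma polynomial_fun_cst a : polynomial_fun (fun=> a).
Proof. by exists a%:MP => v; rewrite mevalC. Qed.

Lemma polynomial_fun_coord i : polynomial_fun (fun v => v 0 i).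
Proof. by exists 'X_i => v; rewrite mevalXU. Qed.

Lemma polynomial_funD g h :
  polynomial_fun g -> polynomial_fun h -> polynomial_fun (fun v => g v + h v).
Proof. by move=> [p Ep] [q Eq]; exists (p + q) => v; rewrite mevalD Ep Eq. Qed.

Lemma polynomial_funM g h :
  polynomial_fun g -> polynomial_fun h -> polynomial_fun (fun v => g v * h v).
Proof. by move=> [p Ep] [q Eq]; exists (p * q) => v; rewrite mevalM Ep Eq. Qed.

Lemma polynomial_funB g h :
  polynomial_fun g -> polynomial_fun h -> polynomial_fun (fun v => g v - h v).
Proof. by move=> [p Ep] [q Eq]; exists (p - q) => v; rewrite mevalB Ep Eq. Qed.

Lemma polynomial_fun_sum (I : Type) (r : seq I) (F : I -> 'rV[K]_n -> K) :
  (forall i, polynomial_fun (F i)) ->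
  polynomial_fun (fun v => \sum_(i <- r) F i v).
Proof.
move=> /boolp.choice[p Ep]; exists (\sum_(i <- r) p i) => v.
by rewrite raddf_sum; apply: eq_bigr => i _; exact: Ep.
Qed.

Lemma polynomial_fun_prod (I : Type) (r : seq I) (F : I -> 'rV[K]_n -> K) :
  (forall i, polynomial_fun (F i)) ->
  polynomial_fun (fun v => \prod_(i <- r) F i v).
Proof.
move=> /boolp.choice[p Ep]; exists (\prod_(i <- r) p i) => v.
by rewrite rmorph_prod; apply: eq_bigr => i _; exact: Ep.
Qed.

Lemma polynomial_fun_det m (A : 'rV[K]_n -> 'M[K]_m) :
  (forall i j, polynomial_fun (fun v => A v i j)) ->
  polynomial_fun (fun v => \det (A v)).
Proof.
move=> Apoly; apply: polynomial_fun_sum => s.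
apply: polynomial_funM; first exact: polynomial_fun_cst.
by apply: polynomial_fun_prod => i; exact: Apoly.
Qed.

Lemma zariski_closed_zeros (I : finType) (F : I -> 'rV[K]_n -> K) :
  (forall i, polynomial_fun (F i)) ->
  zariski_closed (fun v => forall i, F i v = 0).
Proof.
move=> /boolp.choice[p Ep]; exists [seq p i | i <- enum I] => v.
split=> [Fv0 _ /mapP[i _ ->]|pv0 i]; first by rewrite -Ep.
by rewrite Ep pv0 // map_f ?mem_enum.
Qed.

(** If the columns of [A] are independent, Gaussian elimination selects rows
    forming an invertible square matrix; conversely a kernel vector of [A] is a
    kernel vector of every row selection.  Selections with repeated rows are
    allowed: their determinants are zero anyway. *)
Lemma nonzero_kernelP N m (A : 'M[K]_(N, m)) :
  (exists2 u : 'cV[K]_m, u != 0 & A *m u = 0) <->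
  (forall s : {ffun 'I_m -> 'I_N}, \det (rowsub s A) = 0).
Proof.
split=> [[u u_neq0 Au0] s | minors0].
  apply/eqP; apply: contraNT u_neq0 => det_neq0.
  have uA : rowsub s A \in unitmx by rewrite unitmxE unitfE.
  by rewrite -(mulKmx uA u) mul_rowsub_mx Au0 linear0 mulmx0.
have [fullA | ] := boolP (row_full A).
  have := minors0 (fullrankfun fullA).
  have := row_full_unit (rowsub (fullrankfun fullA) A).
  rewrite fullrowsub_full.
  by rewrite unitmxE unitfE => /esym/eqP.
rewrite /row_full -mxrank_tr -/(row_free _) -kermx_eq0.
case/rowV0Pn=> u /sub_kermxP uA u_neq0; exists u^T; last first.
  by apply: trmx_inj; rewrite trmx_mul trmxK uA trmx0.
by apply: contra u_neq0 => /eqP u0; rewrite -(trmxK u) u0 trmx0.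
Qed.

Lemma zariski_closed_nonzero_kernel N m (A : 'rV[K]_n -> 'M[K]_(N, m)) :
  (forall i j, polynomial_fun (fun v => A v i j)) ->
  zariski_closed (fun v => exists2 u : 'cV[K]_m, u != 0 & A v *m u = 0).
Proof.
move=> Apoly.
pose minor (s : {ffun 'I_m -> 'I_N}) v := \det (rowsub s (A v)).
have [|ps minorsP] := @zariski_closed_zeros _ minor.
  move=> s; apply: polynomial_fun_det => i j.
  by have [p Ep] := Apoly (s i) j; exists p => v; rewrite mxE Ep.
by exists ps => v; rewrite nonzero_kernelP; exact: minorsP.
Qed.

End PolynomialFunctions.

(** * Multiplications with prescribed structure constants *)

(** Turns a plain function into a linear map from a mere proof of linearity,
    which suits functions that have no canonical linear structure. *)
Lemma linfunE (K : fieldType) (U V : vectType K) (g : U -> V) :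
  linear g -> linfun g =1 g.
Proof.
by move=> lg; exact: (lfunE (HB.pack g (GRing.isLinear.Build K U V _ g lg))).
Qed.

Section StructureConstants.
Variables (K : fieldType) (e : 4.-tuple 'rV[K]_4).
Hypothesis e_basis : basis_of fullv e.
Implicit Types (x y z : 'rV[K]_4) (c : 'rV[K]_24) (mu : SAlg4 K).

Lemma coord_basisE x : x = \sum_i coord e i x *: tnth e i.
Proof.
rewrite {1}(coord_basis e_basis (memvf x)).
by apply: eq_bigr => i _; rewrite (tnth_nth 0).
Qed.

Lemma coord_tnth i j : coord e i (tnth e j) = (j == i)%:R.
Proof. by rewrite (tnth_nth 0) coord_free ?(basis_free e_basis) // eq_sym. Qed.

Lemma eq_coord x y : (forall k, coord e k x = coord e k y) -> x = y.
Proof.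
move=> Exy; rewrite (coord_basisE x) (coord_basisE y).
by apply: eq_bigr => k _; rewrite Exy.
Qed.

Lemma lfun_eq_basis (V : vectType K) (f g : 'Hom('rV[K]_4, V)) :
  (forall i, f (tnth e i) = g (tnth e i)) -> f = g.
Proof.
move=> Efg; apply/lfunP=> x; rewrite (coord_basisE x) !linear_sum.
by apply: eq_bigr => i _; rewrite !linearZ /= Efg.
Qed.

Lemma linear_eq0 (g : 'rV[K]_4 -> 'rV[K]_4) :
  linear g -> (forall i, g (tnth e i) = 0) -> forall x, g x = 0.
Proof.
move=> lg g0 x; rewrite -(linfunE lg) (_ : linfun g = 0) ?zero_lfunE //.
by apply: lfun_eq_basis => i; rewrite linfunE // g0 zero_lfunE.
Qed.

(** Plucker coordinates of the pair [(x, y)]: alternating in [x] and [y], they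
    are the coordinates of the exterior product on the basis given by
    [index_pairs]. *)
Definition plucker x y (p : 'I_6) : K :=
  let: (i, j) := tnth index_pairs p in
  coord e i x * coord e j y - coord e j x * coord e i y.

Definition table c : 'M[K]_(6, 4) := @vec_mx K 6 4 c.

(** The formula is written with Plucker coordinates so that skew-symmetry and
    polynomial dependence on [c], [x] and [y] can be read off it. *)
Definition bracket c x y : 'rV[K]_4 :=
  \sum_k (\sum_p plucker x y p * table c p k) *: tnth e k.

Lemma coord_bracket c x y k :
  coord e k (bracket c x y) = \sum_p plucker x y p * table c p k.
Proof.
rewrite /bracket; under eq_bigr do rewrite (tnth_nth 0).
by rewrite coord_sum_free ?(basis_free e_basis).
Qed.

Lemma bracketC c x y : bracket c x y = - bracket c y x.
Proof.
apply: eq_coord => k; rewrite linearN /= !coord_bracket -sumrN.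
apply: eq_bigr => p _; rewrite -mulNr /plucker; case: (tnth _ p) => i j.
by rewrite opprB; congr (_ * _); rewrite mulrC [X in _ - X = _]mulrC.
Qed.

Lemma bracket_linear c x : linear (bracket c x).
Proof.
move=> a y z; apply: eq_coord => k.
rewrite linearP /= !coord_bracket mulr_sumr -big_split /=.
apply: eq_bigr => p _; rewrite mulrA -mulrDl /plucker; case: (tnth _ p) => i j.
rewrite !linearP /=; congr (_ * _).
by rewrite !mulrDr mulrN opprD addrACA 2!(mulrCA a).
Qed.

Definition bracket_lfun c : bilin4 K := linfun (fun x => linfun (bracket c x)).

Lemma bracket_lfunE c x y : bracket_lfun c x y = bracket c x y.
Proof.
rewrite /bracket_lfun linfunE ?linfunE //; first exact: bracket_linear.
move=> a {}x x'; apply/lfunP=> {}y; rewrite add_lfunE scale_lfunE.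
rewrite !linfunE; try exact: bracket_linear.
by rewrite !(bracketC _ _ y) bracket_linear opprD scalerN.
Qed.

Lemma bracket_lfun_skew c : bracket_lfun c \in @skew_pred K.
Proof. by apply/skew_predP => x y; rewrite !bracket_lfunE bracketC. Qed.

Definition salg_of c : SAlg4 K := SAlg4_of (bracket_lfun_skew c).

Lemma salg_ofE c x y : salg_of c x y = bracket c x y.
Proof. exact: bracket_lfunE. Qed.

Lemma structure_constantsE mu p k :
  table (structure_constants e mu) p k =
  coord e k (mu (tnth e (tnth index_pairs p).1)
                (tnth e (tnth index_pairs p).2)).
Proof. by rewrite /table mxvecK mxE. Qed.

Lemma structure_constants_linear : linear (@structure_constants K e).
Proof.
move=> a mu nu; apply: (can_inj (@vec_mxK K 6 4)); apply/matrixP=> p k.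
rewrite linearP /= -!/(table _).
transitivity (a * table (structure_constants e mu) p k
                + table (structure_constants e nu) p k); last by rewrite !mxE.
rewrite !structure_constantsE.
have Emu : salg_mul (a *: mu + nu) = a *: salg_mul mu + salg_mul nu.
  exact: (@linearP K _ _ _ (\val : SAlg4 K -> bilin4 K)).
by rewrite Emu !add_lfunE !scale_lfunE linearP.
Qed.

Lemma plucker_basis p q :
  plucker (tnth e (tnth index_pairs q).1) (tnth e (tnth index_pairs q).2) p
  = (q == p)%:R.
Proof.
rewrite /plucker !(tnth_nth (ord0, ord0)).
case: p => [[|[|[|[|[|[|//]]]]]]] ?; case: q => [[|[|[|[|[|[|//]]]]]]] ?;
  by rewrite /= !coord_tnth -!val_eqE /= !inordK //=
             ?(mulr0, mul0r, mulr1, subr0).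
Qed.

Lemma salg_ofK c : structure_constants e (salg_of c) = c.
Proof.
apply: (can_inj (@vec_mxK K 6 4)); apply/matrixP=> q k.
rewrite -!/(table _) structure_constantsE salg_ofE coord_bracket (bigD1 q) //=.
rewrite plucker_basis eqxx mul1r big1 ?addr0 // => p p_neq_q.
by rewrite plucker_basis eq_sym (negPf p_neq_q) mul0r.
Qed.

Lemma mem_index_pairs (i j : 'I_4) : (i < j)%N -> (i, j) \in index_pairs.
Proof.
by case: i => [[|[|[|[|//]]]]] ?; case: j => [[|[|[|[|//]]]]] ? // _;
  rewrite !inE /eq_op /= -!val_eqE /= !inordK.
Qed.

(** Skew-symmetry alone gives 2 mu(x, x) = 0, whence the assumption that 2 is
    not zero: over a field of characteristic 2 the products e_i e_i would be
    free, and not recorded by the structure constants. *)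
Lemma structure_constants_inj :
  2 != 0 :> K -> injective (@structure_constants K e).
Proof.
move=> two_neq0 mu nu Emn; apply: val_inj => /=.
have skew (la : SAlg4 K) x y : la x y = - la y x.
  by have /skew_predP := salg_mul_skew la; apply.
have diag (la : SAlg4 K) x : la x x = 0.
  apply/eqP; rewrite -(inj_eq (scalerI two_neq0)) scaler0 scaler_nat mulr2n.
  by rewrite [X in X + _]skew addNr.
have upper (i j : 'I_4) : (i < j)%N ->
    mu (tnth e i) (tnth e j) = nu (tnth e i) (tnth e j).
  move=> /mem_index_pairs/tnthP[p Ep]; apply: eq_coord => k.
  have := congr1 (fun c => table c p k) Emn.
  by rewrite !structure_constantsE -Ep.
have basis (i j : 'I_4) : mu (tnth e i) (tnth e j) = nu (tnth e i) (tnth e j).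
  have [ltij|ltji|/val_inj->] := ltngtP i j; first exact: upper.
    by rewrite skew upper // -skew.
  by rewrite !diag.
by apply: lfun_eq_basis => i; apply: lfun_eq_basis => j; exact: basis.
Qed.

End StructureConstants.

(** * The Hom-Lie condition as a linear system *)

Section HomJacobian.
Variables (K : fieldType) (e : 4.-tuple 'rV[K]_4).
Hypothesis e_basis : basis_of fullv e.
Implicit Types (x y z : 'rV[K]_4) (c : 'rV[K]_24) (mu : SAlg4 K).
Implicit Types (f : 'End('rV[K]_4)).

Definition hom_jacobian mu f x y z : 'rV[K]_4 :=
  mu (mu x y) (f z) + mu (mu y z) (f x) + mu (mu z x) (f y).

(** This symmetry reduces properties of the last two vector arguments to
    properties of the first one. *)
Lemma hom_jacobian_rot mu f x y z :
  hom_jacobian mu f x y z = hom_jacobian mu f y z x.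
Proof. by rewrite /hom_jacobian -addrA addrC. Qed.

Lemma hom_jacobian_linear mu f y z :
  linear (fun x => hom_jacobian mu f x y z).
Proof.
move=> a x x'; rewrite /hom_jacobian.
rewrite !(linearP, add_lfunE, scale_lfunE) /=.
rewrite !scalerDr.
by rewrite [RHS]addrACA; congr (_ + _); rewrite [RHS]addrACA.
Qed.

Lemma hom_jacobian_linear_f mu x y z :
  linear (fun f => hom_jacobian mu f x y z).
Proof.
move=> a f g; rewrite /hom_jacobian !add_lfunE !scale_lfunE !linearP /=.
by rewrite !scalerDr [RHS]addrACA; congr (_ + _); rewrite [RHS]addrACA.
Qed.

Lemma hom_jacobian_eq0 mu f :
  (forall i j k, hom_jacobian mu f (tnth e i) (tnth e j) (tnth e k) = 0) ->
  forall x y z, hom_jacobian mu f x y z = 0.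
Proof.
move=> J0 x y z.
apply: (linear_eq0 e_basis (hom_jacobian_linear mu f y z)) => i.
rewrite hom_jacobian_rot.
apply: (linear_eq0 e_basis (hom_jacobian_linear mu f z _)) => j.
rewrite hom_jacobian_rot.
apply: (linear_eq0 e_basis (hom_jacobian_linear mu f _ _)) => k.
by rewrite hom_jacobian_rot.
Qed.

(** Maps from structure constants to vectors whose coordinates are polynomial.
    Being closed under the product of the algebra with structure constants
    [c], they contain every algebra expression in fixed vectors. *)
Definition polynomial_vec (X : 'rV[K]_24 -> 'rV[K]_4) : Prop :=
  forall k, polynomial_fun (fun c => coord e k (X c)).

Lemma polynomial_vec_cst x : polynomial_vec (fun=> x).
Proof. by move=> k; exact: polynomial_fun_cst. Qed.

Lemma polynomial_vecD X Y :
  polynomial_vec X -> polynomial_vec Y -> polynomial_vec (fun c => X c + Y c).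
Proof.
move=> pX pY k; have [p Ep] := polynomial_funD (pX k) (pY k).
by exists p => c; rewrite linearD -Ep.
Qed.

Lemma polynomial_vec_mul X Y :
  polynomial_vec X -> polynomial_vec Y ->
  polynomial_vec (fun c => salg_of e_basis c (X c) (Y c)).
Proof.
move=> pX pY k.
suff [p Ep] : polynomial_fun
    (fun c => \sum_p plucker e (X c) (Y c) p * table c p k).
  by exists p => c; rewrite salg_ofE coord_bracket.
apply: polynomial_fun_sum => p; apply: polynomial_funM.
  rewrite /plucker; case: (tnth _ p) => i j.
  by apply: polynomial_funB; apply: polynomial_funM.
have [q Eq] := @polynomial_fun_coord K 24 (@mxvec_index 6 4 p k).
by exists q => c; rewrite mxE Eq.
Qed.

Lemma polynomial_hom_jacobian f x y z :
  polynomial_vec (fun c => hom_jacobian (salg_of e_basis c) f x y z).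
Proof.
by do !apply: polynomial_vecD; do !apply: polynomial_vec_mul;
  exact: polynomial_vec_cst.
Qed.

Notation endo_basis := (vbasis {:'End('rV[K]_4)}).
Notation endo_dim := (\dim {:'End('rV[K]_4)}).
Notation equation := ('I_4 * 'I_4 * 'I_4 * 'I_4)%type.

(** The matrix of the linear system whose unknowns are the coordinates of [f]
    on a basis of the endomorphisms.  A row is indexed by a basis triple
    [(i, j, k)] and a coordinate [l] of the Hom-Jacobi expression. *)
Definition hom_lie_mx c : 'M[K]_(#|{: equation}|, endo_dim) :=
  \matrix_(r, s) let: (i, j, k, l) := enum_val r in
    coord e l (hom_jacobian (salg_of e_basis c) (tnth endo_basis s)
                 (tnth e i) (tnth e j) (tnth e k)).

Definition endo_of (u : 'cV[K]_endo_dim) : 'End('rV[K]_4) :=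
  \sum_s u s 0 *: tnth endo_basis s.

Lemma hom_lie_mx_ker c u :
  hom_lie_mx c *m u = 0 <->
  forall x y z, hom_jacobian (salg_of e_basis c) (endo_of u) x y z = 0.
Proof.
have mulE r : (hom_lie_mx c *m u) r 0 = let: (i, j, k, l) := enum_val r in
    coord e l (hom_jacobian (salg_of e_basis c) (endo_of u)
                 (tnth e i) (tnth e j) (tnth e k)).
  rewrite mxE; under eq_bigr do rewrite mxE.
  case: (enum_val r) => [[[i j] k] l].
  rewrite -(linfunE (hom_jacobian_linear_f _ _ _ _)) /endo_of !linear_sum.
  apply: eq_bigr => s _.
  by rewrite !linearZ /= mulrC linfunE //; exact: hom_jacobian_linear_f.
split=> [Mu0 | J0].
  apply: hom_jacobian_eq0 => i j k; apply: (eq_coord e_basis) => l.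
  have := mulE (enum_rank (i, j, k, l)).
  by rewrite enum_rankK Mu0 mxE linear0 => ->.
apply/colP=> r; rewrite mulE mxE; case: (enum_val r) => [[[i j] k] l].
by rewrite J0 linear0.
Qed.

Lemma hom_lie_mxP c :
  hom_lie (salg_of e_basis c) <-> 
    exists2 u : 'cV[K]_endo_dim, u != 0 & hom_lie_mx c *m u = 0.
Proof.
split=> [[f f_neq0 Jf] | [u u_neq0 /hom_lie_mx_ker Ju]].
  have Ef : endo_of (\col_s coord endo_basis s f) = f.
    rewrite [RHS](coord_vbasis (memvf f)) /endo_of.
    by apply: eq_bigr => s _; rewrite mxE (tnth_nth 0).
  exists (\col_s coord endo_basis s f);
    last by apply/hom_lie_mx_ker; rewrite Ef.
  by apply: contra_neq f_neq0 => u0; rewrite -Ef u0 /endo_of big1 // => s _;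
    rewrite mxE scale0r.
exists (endo_of u); last exact: Ju.
apply: contra_neq u_neq0 => u0; apply/colP=> s; rewrite mxE.
have : coord endo_basis s (endo_of u) = 0 by rewrite u0 linear0.
rewrite /endo_of; under eq_bigr do rewrite (tnth_nth 0).
by rewrite coord_sum_free // (basis_free (vbasisP _)).
Qed.

Lemma zariski_closed_hom_lie :
  zariski_closed (fun c => hom_lie (salg_of e_basis c)).
Proof.
have [|ps closed] := @zariski_closed_nonzero_kernel K 24 _ _ hom_lie_mx.
  move=> r s; rewrite /hom_lie_mx; case Er: (enum_val r) => [[[i j] k] l].
  have [p Ep] := @polynomial_hom_jacobian (tnth endo_basis s)
    (tnth e i) (tnth e j) (tnth e k) l.
  by exists p => c; rewrite mxE Er Ep.
by exists ps => c; rewrite hom_lie_mxP.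
Qed.

End HomJacobian.

(** * An algebra that is not Hom-Lie *)

Section Witness.
Variables (K : fieldType) (e : 4.-tuple 'rV[K]_4).
Hypothesis e_basis : basis_of fullv e.

(** The products e0e1, e0e2, e0e3, e1e2, e1e3, e2e3 are the basis vectors with
    these indices; the out-of-range index 4 stands for a zero product. *)
Definition witness_index : seq nat := [:: 4; 0; 3; 3; 2; 1].

Definition witness : 'rV[K]_24 :=
  @mxvec K 6 4 (\matrix_(p, k) (nth 0%N witness_index p == k)%:R).

Local Notation b i := (@inord 3 i%N).
Local Notation co i := (coord e (b i%N)).

Lemma coord_witness (x y : 'rV[K]_4) : let m := salg_of e_basis witness in
  [/\ co 0 (m x y) = co 0 x * co 2 y - co 2 x * co 0 y,
      co 1 (m x y) = co 2 x * co 3 y - co 3 x * co 2 y,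
      co 2 (m x y) = co 1 x * co 3 y - co 3 x * co 1 y
    & co 3 (m x y) = co 0 x * co 3 y - co 3 x * co 0 y
                    + (co 1 x * co 2 y - co 2 x * co 1 y)].
Proof.
split; rewrite salg_ofE (coord_bracket e_basis) !big_ord_recl big_ord0 /plucker;
  rewrite !(tnth_nth (ord0, ord0)) /table mxvecK !mxE /= !inordK //=;
  by rewrite !(mulr0, mulr1, add0r, addr0).
Qed.

(** Expands the given coordinate of the Hom-Jacobi expression, discards the
    terms known to vanish, and reads the remaining equation, of the form
    [a = 0] or [- a = 0]. *)
Ltac entry_vanishes eqn mE :=
  have := eqn; rewrite /= !linearD /= !mE //= ;
  repeat match goal with known : _ = 0 |- _ => rewrite known end;
  rewrite ?(linear0, mul0r, mulr0, mul1r, mulr1, oppr0, opprK, mulNr, sub0r,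
            add0r, addr0, subr0);
  move=> /eqP; rewrite ?oppr_eq0 => /eqP.

Lemma witness_not_hom_lie : ~ hom_lie (salg_of e_basis witness).
Proof.
case=> f f_neq0 J; move/negP: f_neq0; apply; apply/eqP.
set m := salg_of e_basis witness in J.
have m0 x y : co 0 (m x y) = co 0 x * co 2 y - co 2 x * co 0 y.
  by case: (coord_witness x y).
have m1 x y : co 1 (m x y) = co 2 x * co 3 y - co 3 x * co 2 y.
  by case: (coord_witness x y).
have m2 x y : co 2 (m x y) = co 1 x * co 3 y - co 3 x * co 1 y.
  by case: (coord_witness x y).
have m3 x y : co 3 (m x y) = co 0 x * co 3 y - co 3 x * co 0 y
                    + (co 1 x * co 2 y - co 2 x * co 1 y).
  by case: (coord_witness x y).
have be i l : (i < 4)%N -> (l < 4)%N -> co l (tnth e (b i)) = (i == l)%:R.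
  by move=> lti ltl; rewrite coord_tnth // -val_eqE /= !inordK.
have mE := (m0, m1, m2, m3, be).
have eqn i j k l := congr1 (coord e (b l))
  (J (tnth e (b i)) (tnth e (b j)) (tnth e (b k))).
(* The order of the entries makes the system triangular: each equation brings
   in a single entry that does not occur in the preceding ones. *)
have F12 : co 2 (f (tnth e (b 1))) = 0
  by entry_vanishes (eqn 0%N 1%N 2%N 0%N) mE.
have F02 : co 2 (f (tnth e (b 0))) = 0
  by entry_vanishes (eqn 0%N 1%N 2%N 1%N) mE.
have F01 : co 1 (f (tnth e (b 0))) = 0
  by entry_vanishes (eqn 0%N 1%N 2%N 2%N) mE.
have F00 : co 0 (f (tnth e (b 0))) = 0
  by entry_vanishes (eqn 0%N 1%N 3%N 0%N) mE.
have F13 : co 3 (f (tnth e (b 1))) = 0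
  by entry_vanishes (eqn 0%N 1%N 2%N 3%N) mE.
have F03 : co 3 (f (tnth e (b 0))) = 0
  by entry_vanishes (eqn 0%N 1%N 3%N 1%N) mE.
have F11 : co 1 (f (tnth e (b 1))) = 0
  by entry_vanishes (eqn 0%N 1%N 3%N 2%N) mE.
have F10 : co 0 (f (tnth e (b 1))) = 0
  by entry_vanishes (eqn 0%N 1%N 3%N 3%N) mE.
have F32 : co 2 (f (tnth e (b 3))) = 0
  by entry_vanishes (eqn 0%N 2%N 3%N 0%N) mE.
have F22 : co 2 (f (tnth e (b 2))) = 0
  by entry_vanishes (eqn 0%N 2%N 3%N 1%N) mE.
have F21 : co 1 (f (tnth e (b 2))) = 0
  by entry_vanishes (eqn 0%N 2%N 3%N 2%N) mE.
have F20 : co 0 (f (tnth e (b 2))) = 0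
  by entry_vanishes (eqn 1%N 2%N 3%N 0%N) mE.
have F33 : co 3 (f (tnth e (b 3))) = 0
  by entry_vanishes (eqn 0%N 2%N 3%N 3%N) mE.
have F23 : co 3 (f (tnth e (b 2))) = 0
  by entry_vanishes (eqn 1%N 2%N 3%N 1%N) mE.
have F31 : co 1 (f (tnth e (b 3))) = 0
  by entry_vanishes (eqn 1%N 2%N 3%N 2%N) mE.
have F30 : co 0 (f (tnth e (b 3))) = 0
  by entry_vanishes (eqn 1%N 2%N 3%N 3%N) mE.
apply: (lfun_eq_basis e_basis) => i; rewrite zero_lfunE.
apply: (eq_coord e_basis) => l; rewrite linear0 -(inord_val i) -(inord_val l).
case: i => [[|[|[|[|//]]]]] ?; by case: l => [[|[|[|[|//]]]]].
Qed.

End Witness.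

(** * The variety of Hom-Lie algebras *)

Theorem theorem4 (K : closedFieldType) (char0 : [pchar K] =i pred0)
    (e : 4.-tuple 'rV[K]_4) (e_basis : basis_of fullv e) :
  [/\ linear (@structure_constants K e),
      bijective (@structure_constants K e),
      zariski_closed
        (fun c : 'rV[K]_24 =>
           exists2 mu : SAlg4 K, hom_lie mu & structure_constants e mu = c)
    & exists mu : SAlg4 K, ~ hom_lie mu].
Proof.
have two_neq0 : 2 != 0 :> K.
  by apply/negP=> two_eq0; have := char0 2; rewrite !inE /= two_eq0.
have scK := salg_ofK e_basis.
have sc_inj := structure_constants_inj e_basis two_neq0.
split.
- exact: structure_constants_linear.
- by exists (salg_of e_basis) => // mu; apply: sc_inj; exact: scK.
- have [ps closed] := zariski_closed_hom_lie e_basis.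
  exists ps => c; rewrite -closed.
  split=> [[mu mu_hl mu_c] | c_hl]; last by exists (salg_of e_basis c).
  by rewrite (_ : salg_of e_basis c = mu) //; apply: sc_inj; rewrite scK.
- by exists (salg_of e_basis (witness K)); exact: witness_not_hom_lie.
Qed.
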